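(* Let $X$ be a set, let $\Pi$ be a set whose elements are families (sets) of maps $d : X \times X \to \mathbb{R}^+$, and let $\prec_{\Pi}$ be a preorder on $\Pi$ such that for all $\mathscr{P}, \mathscr{P}' \in \Pi$, $$\mathscr{P}' \prec_{\Pi} \mathscr{P} \iff \{d'\} \prec_{\Pi} \mathscr{P} \ \text{ for all } d' \in \mathscr{P}'.$$ For $\mathscr{P} \in \Pi$ put $${\prec_{\Pi}}(\mathscr{P}) := \{ d : X \times X \to \mathbb{R}^+ \ :\ \{d\} \prec_{\Pi} \mathscr{P}\}.$$ Let $\mathscr{R} \in \Pi$. Then $\mathscr{R}$ is the real structure generated by some $\mathscr{P} \in \Pi$, i.e. there exists $\mathscr{P} \in \Pi$ with $\mathscr{R} = {\prec_{\Pi}}(\mathscr{P})$, if and only if $${\prec_{\Pi}}(\mathscr{R}) \subseteq \mathscr{R},$$ that is, $\{d\} \prec_{\Pi} \mathscr{R}$ implies $d \in \mathscr{R}$. Moreover, the condition ${\prec_{\Pi}}(\mathscr{R}) \subseteq \mathscr{R}$ is equivalent to ${\prec_{\Pi}}(\mathscr{R}) = \mathscr{R}$.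
   Context: $\mathbb{R}^+$ denotes the set of nonnegative real numbers. A preorder is a reflexive and transitive relation. It is understood that $\{d\} \in \Pi$ whenever $d \in \mathscr{P}$ for some $\mathscr{P} \in \Pi$, so that the displayed condition on $\prec_{\Pi}$ makes sense; writing $\{d\} \prec_{\Pi} \mathscr{P}$ includes the requirement $\{d\} \in \Pi$. For $\mathscr{P} \in \Pi$, the family ${\prec_{\Pi}}(\mathscr{P})$ is called the real structure generated by $\mathscr{P}$ (through the preorder $\prec_{\Pi}$). *)

(* Defs.v *)
From mathcomp Require Import all_boot all_order all_algebra.
From mathcomp Require Import boolp classical_sets reals interval_inference.
Set Implicit Arguments.
Unset Strict Implicit.
Unset Printing Implicit Defensive.

Local Open Scope classical_set_scope.

Definition dmap (R : realType) (X : Type) : Type := X * X -> {nonneg R}%R.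

Definition dfamily (R : realType) (X : Type) : Type := set (dmap R X).

(* [prec] is a relation on the set [Pi], i.e. a subset of [Pi `*` Pi]; so
   [prec [set d] P] includes the requirement [Pi [set d]]. *)
Record preorder_on (T : Type) (Pi : set T) (prec : T -> T -> Prop) : Prop :=
  PreorderOn {
    preorder_on_dom : forall P Q, prec P Q -> Pi P /\ Pi Q;
    preorder_on_refl : forall P, Pi P -> prec P P;
    preorder_on_trans : forall P Q S,
      Pi P -> Pi Q -> Pi S -> prec P Q -> prec Q S -> prec P S
  }.

Definition generated (R : realType) (X : Type)
    (prec : dfamily R X -> dfamily R X -> Prop) (P : dfamily R X) : dfamily R X :=
  [set d | prec [set d] P].

(* Main.v *)
Require Import Defs.
From mathcomp Require Import all_boot all_order all_algebra.
From mathcomp Require Import boolp classical_sets reals interval_inference.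
Set Implicit Arguments.
Unset Strict Implicit.
Unset Printing Implicit Defensive.

Local Open Scope classical_set_scope.

(** The operator [generated prec] behaves like a closure operator. Reading the
    singleton criterion from left to right at [prec P P] shows that it is
    extensive; transitivity of [prec] shows that it is monotone. Read from right
    to left, the criterion says that a family all of whose singletons lie below
    [P] lies itself below [P]: a generated structure [generated prec P] that
    belongs to [Pi] therefore lies below [P], and transitivity gives
    idempotence on it. Hence the generated members of [Pi] are exactly the fixed
    points of the operator, and, by extensivity, a fixed point is the same as
    a family that contains what it generates. *)

(** Reflexivity puts [P] below itself, and the singleton criterion transfers this
    to each member of [P]. *)
Lemma sub_generated (R : realType) (X : Type)
    (Pi : set (dfamily R X)) (prec : dfamily R X -> dfamily R X -> Prop)
    (prec_preorder : preorder_on Pi prec)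
    (prec_singletons : forall P P' : dfamily R X, Pi P -> Pi P' ->
       (prec P' P <-> (forall d' : dmap R X, P' d' -> prec [set d'] P)))
    (P : dfamily R X) :
  Pi P -> P `<=` generated prec P.
Proof.
move=> PiP; apply/(prec_singletons _ _ PiP PiP).
exact: (preorder_on_refl prec_preorder).
Qed.

Lemma generated_mono (R : realType) (X : Type)
    (Pi : set (dfamily R X)) (prec : dfamily R X -> dfamily R X -> Prop)
    (prec_preorder : preorder_on Pi prec) (P Q : dfamily R X) :
  prec P Q -> generated prec P `<=` generated prec Q.
Proof.
move=> PQ d dP.
have [PiP PiQ] := preorder_on_dom prec_preorder PQ.
have [Pid _] := preorder_on_dom prec_preorder dP.
exact: (preorder_on_trans prec_preorder Pid PiP PiQ dP PQ).
Qed.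

Theorem theorem2p1 (R : realType) (X : Type)
    (Pi : set (dfamily R X)) (prec : dfamily R X -> dfamily R X -> Prop)
    (Pi_singleton : forall (P : dfamily R X) (d : dmap R X),
       Pi P -> P d -> Pi [set d])
    (prec_preorder : preorder_on Pi prec)
    (prec_singletons : forall P P' : dfamily R X, Pi P -> Pi P' ->
       (prec P' P <-> (forall d' : dmap R X, P' d' -> prec [set d'] P)))
    (Rs : dfamily R X) (Pi_Rs : Pi Rs) :
  ((exists P : dfamily R X, Pi P /\ Rs = generated prec P) <->
     generated prec Rs `<=` Rs) /\
  (generated prec Rs `<=` Rs <-> generated prec Rs = Rs).
Proof.
have Rs_sub := sub_generated prec_preorder prec_singletons Pi_Rs.
have closedE : generated prec Rs `<=` Rs <-> generated prec Rs = Rs.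
  by split=> [sub_Rs | ->//]; apply/seteqP.
split=> //; split=> [[P [PiP defRs]] | /closedE genRs]; last by exists Rs.
have Rs_le_P : prec Rs P.
  by apply/(prec_singletons _ _ PiP Pi_Rs) => d; rewrite defRs.
rewrite [X in _ `<=` X]defRs.
exact: (generated_mono prec_preorder Rs_le_P).
Qed.
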